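(* Let $\alpha\in(0,1)$, $\beta>0$, $\varepsilon\in(0,1]$, and assume $0<p_{\mathrm{ref}}(q)<1$ for $\rho_{\mathcal Q}$-almost every $q$. Let $\pi_0=\pi_{\mathrm{ref}}$ and, for $n\ge1$, let $$\pi_n=\arg\max_\pi\ \mathbb{E}_{q\sim\rho_{\mathcal Q}}\Big(\mathbb{E}_{o\sim\pi(\cdot|q)}A_{n-1}(q,o)-\beta\big(\alpha\,\mathsf{KL}(\pi(\cdot|q)\|\pi_{\mathrm{ref}}(\cdot|q))+(1-\alpha)\,\mathsf{KL}(\pi(\cdot|q)\|\pi_{n-1}(\cdot|q))\big)\Big),$$ where $A_{n-1}(q,o)=\omega^+_\varepsilon(p_{n-1}(q))$ if $r(q,o)=1$, $A_{n-1}(q,o)=-\omega^-_\varepsilon(p_{n-1}(q))$ if $r(q,o)=0$, and $p_n(q)=\mathbb{P}_{o\sim\pi_n(\cdot|q)}(r(q,o)=1)$. Then, for $\rho_{\mathcal Q}$-almost every $q$ and all $n\ge1$, $$\mathrm{logit}\,p_n(q)=\alpha\,\mathrm{logit}(p_{\mathrm{ref}}(q))+(1-\alpha)\,\mathrm{logit}(p_{n-1}(q))+(1-\alpha)\Big(D_\alpha(p_{\mathrm{ref},F}\|p_{n-1,F})-D_\alpha(p_{\mathrm{ref},S}\|p_{n-1,S})\Big)+\frac{\Omega_\varepsilon(p_{n-1}(q))}{\beta}.$$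
   Context: $\rho_{\mathcal Q}$ is a probability distribution on the prompt space $\mathcal Q$; $\mathcal O$ is the outcome space with a fixed $\sigma$-finite base measure (counting measure when $\mathcal O$ is countable). A policy $\pi$ assigns (measurably) to each $q$ a probability density $\pi(\cdot|q)$ on $\mathcal O$; the argmax is over all policies. The reward $r:\mathcal Q\times\mathcal O\to\{0,1\}$ is measurable; $\pi_{\mathrm{ref}}$ is a fixed reference policy with probability of success $p_{\mathrm{ref}}(q)=\mathbb{P}_{o\sim\pi_{\mathrm{ref}}(\cdot|q)}(r(q,o)=1)$. $\mathsf{KL}$ is the Kullback–Leibler divergence, with values in $[0,\infty]$ (the objective is $-\infty$ when an expected divergence is infinite). $\omega^+_{\varepsilon}(p)=\frac{1-p}{\sqrt{p(1-p)+\varepsilon}}$, $\omega^-_{\varepsilon}(p)=\frac{p}{\sqrt{p(1-p)+\varepsilon}}$, $\Omega_\varepsilon(p)=\frac{1}{\sqrt{p(1-p)+\varepsilon}}$; $\mathrm{logit}(p)=\log\frac{p}{1-p}$. The success and failure conditional densities (given $q$) are $$p_{\mathrm{ref},S}(o|q)=\frac{\pi_{\mathrm{ref}}(o|q)\mathbf 1_{r(q,o)=1}}{p_{\mathrm{ref}}(q)},\quad p_{n-1,S}(o|q)=\frac{\pi_{n-1}(o|q)\mathbf 1_{r(q,o)=1}}{p_{n-1}(q)},$$ $$p_{\mathrm{ref},F}(o|q)=\frac{\pi_{\mathrm{ref}}(o|q)\mathbf 1_{r(q,o)=0}}{1-p_{\mathrm{ref}}(q)},\quad p_{n-1,F}(o|q)=\frac{\pi_{n-1}(o|q)\mathbf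 1_{r(q,o)=0}}{1-p_{n-1}(q)}.$$ $D_\alpha(P\|Q)=\frac{1}{\alpha-1}\log\int p^\alpha q^{1-\alpha}$ is the Rényi divergence of order $\alpha\in(0,1)$ between distributions with densities $p,q$. *)

(* Defs.v *)
From HB Require Import structures.
From mathcomp Require Import all_boot all_order all_algebra.
From mathcomp Require Import all_classical all_reals all_analysis.
Set Implicit Arguments.
Unset Strict Implicit.
Unset Printing Implicit Defensive.
Import Order.TTheory GRing.Theory Num.Theory.
Import numFieldNormedType.Exports.
Local Open Scope classical_set_scope.
Local Open Scope ring_scope.

Section weights.
Context {R : realType}.
Implicit Types (eps p : R).

Definition omega_plus eps p : R := (1 - p) / Num.sqrt (p * (1 - p) + eps).
Definition omega_minus eps p : R := p / Num.sqrt (p * (1 - p) + eps).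
Definition Omega eps p : R := (Num.sqrt (p * (1 - p) + eps))^-1.

(* Meaningful for 0 < p < 1 only: the library's [ln] is 0 outside ]0, +oo[. *)
Definition logit p : R := ln (p / (1 - p)).

End weights.

Section divergences.
Context {d : measure_display} {O : measurableType d} {R : realType}.
Variable mu : {measure set O -> \bar R}.
Implicit Types f g : O -> R.

(* The integrand f log (f / g), with 0 log (0 / b) = 0 and
   a log (a / 0) = +oo for a > 0. *)
Definition KL_integrand (a b : R) : \bar R :=
  if a == 0 then 0%E else if b == 0 then +oo%E else (a * ln (a / b))%:E.

Definition KL f g : \bar R := (\int[mu]_o KL_integrand (f o) (g o))%E.

(* Extended-real valued: [lne 0 = -oo], so for 0 < alpha < 1 the divergence of
   mutually singular distributions is +oo. *)
Definition renyi (alpha : R) f g : \bar R :=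
  (((alpha - 1)^-1)%:E *
   lne (\int[mu]_o (f o `^ alpha * g o `^ (1 - alpha))%:E))%E.

End divergences.

Section policies.
Context {dQ dO : measure_display}.
Context {Q : measurableType dQ} {O : measurableType dO} {R : realType}.
Variables (rho : probability Q R) (mu : {sigma_finite_measure set O -> \bar R}).
Variable r : Q -> O -> bool.
Implicit Types pi : Q -> O -> R.

(* [pi q] is the density of the policy at [q] with respect to the base measure
   [mu]; measurability in [q] is joint measurability of the density. *)
Definition is_policy pi : Prop :=
  [/\ measurable_fun [set: Q * O] (fun x : Q * O => pi x.1 x.2),
      forall q o, 0 <= pi q o
    & forall q, (\int[mu]_o (pi q o)%:E = 1)%E].

(* Probability of success of [pi] at [q]. *)
Definition psucc pi (q : Q) : R := \int[mu]_(o in [set o | r q o]) pi q o.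

(* Success and failure conditional densities. *)
Definition cond_S pi (q : Q) (o : O) : R :=
  pi q o * (r q o)%:R / psucc pi q.
Definition cond_F pi (q : Q) (o : O) : R :=
  pi q o * (~~ r q o)%:R / (1 - psucc pi q).

Definition advantage (eps : R) pi (q : Q) (o : O) : R :=
  if r q o then omega_plus eps (psucc pi q)
  else - omega_minus eps (psucc pi q).

(* Since the advantage is bounded (for eps > 0) and the divergences are
   nonnegative, this integral is -oo exactly when one of the two expected
   divergences with positive weight is +oo. *)
Definition objective (alpha beta eps : R) (piref piold pi : Q -> O -> R)
    : \bar R :=
  (\int[rho]_q
     (\int[mu]_o (pi q o * advantage eps piold q o)%:E
      - beta%:E * (alpha%:E * KL mu (pi q) (piref q)
                   + (1 - alpha)%:E * KL mu (pi q) (piold q))))%E.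

(* A maximizer is determined only up to null sets, so argmax is a predicate. *)
Definition is_argmax (J : (Q -> O -> R) -> \bar R) pi : Prop :=
  is_policy pi /\ forall pi', is_policy pi' -> (J pi' <= J pi)%E.

End policies.

(* Main.v *)
Require Import Defs.
From HB Require Import structures.
From mathcomp Require Import all_boot all_order all_algebra.
From mathcomp Require Import all_classical all_reals all_analysis.
From mathcomp Require Import measurable_realfun ring.
Set Implicit Arguments.
Unset Strict Implicit.
Unset Printing Implicit Defensive.
Import Order.TTheory GRing.Theory Num.Theory.
Import numFieldNormedType.Exports.
Local Open Scope classical_set_scope.
Local Open Scope ring_scope.

(* Fix q and write a, b for the densities of the reference and of the previous
   policy, w = a^alpha b^(1-alpha) exp(A/beta) and Z for the integral of w.  By
   the Gibbs variational principle, which is the inequality ln x <= x - 1 with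
   x = w / (Z f) integrated against f, the inner objective of a density f is at
   most beta ln Z, with equality exactly for f = w / Z almost everywhere.

   This identifies the maximizer of the integrated objective for almost every q
   only if q |-> beta ln Z has a finite expectation, as otherwise every policy
   could have objective -oo.  Finiteness comes from a two-sided bound, uniform
   in q: if e^-K a <= b <= e^K a, then w / Z satisfies the same bounds with
   another constant, since the advantage is at most 1 / sqrt eps.  By induction
   every iterate is comparable to the reference in this sense.

   Integrating w / Z over the successes and the failures gives
   p / (1 - p) = e^(Omega/beta) I_S / I_F, where I_S and I_F are the integrals
   of a^alpha b^(1-alpha), which the Renyi divergences express. *)

(** * Integrals and almost-everywhere inequalities *)

Section ae_integral.
Context {d : measure_display} {T : measurableType d} {R : realType}.
Variable mu : {measure set T -> \bar R}.
Implicit Types f g h : T -> \bar R.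

Lemma integral_funepos_lty f g : measurable_fun setT f -> mu.-integrable setT g ->
  {ae mu, forall x, (f x <= g x)%E} -> (\int[mu]_x f^\+%E x < +oo)%E.
Proof.
move=> mf ig fg.
have := integrable_lty measurableT (integrable_funepos measurableT ig).
apply: le_lt_trans; apply: ae_ge0_le_integral => //.
- exact: measurable_funepos.
- by apply: measurable_funepos; exact: measurable_int ig.
- by apply: filterS fg => x fg _; rewrite !funeposE ge_max !le_max fg lexx orbT.
Qed.

Lemma integrable_funeposneg f : measurable_fun setT f ->
  (\int[mu]_x f^\+%E x < +oo)%E -> (\int[mu]_x f^\-%E x < +oo)%E ->
  mu.-integrable setT f.
Proof.
move=> mf fp fn; apply/integrableP; split => //.
rewrite (eq_integral (f^\+ \+ f^\-)%E); last by move=> x _; have /(congr1 (@^~ x)) := fune_abse f.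
rewrite ge0_integralD//; last 2 first.
- exact: measurable_funepos.
- exact: measurable_funeneg.
exact: lte_add_pinfty.
Qed.

Lemma integral_funeneg_lty f g : measurable_fun setT f -> mu.-integrable setT g ->
  {ae mu, forall x, (g x <= f x)%E} -> (\int[mu]_x f^\-%E x < +oo)%E.
Proof.
move=> mf ig gf; rewrite -funeposN.
apply: (@integral_funepos_lty _ (-%E \o g)%E).
- by apply: measurableT_comp mf; exact: oppe_measurable.
- exact: integrableN.
- by apply: filterS gf => x gf /=; rewrite leeN2.
Qed.

(** The integrable lower bound keeps the negative part finite. The integral is the difference of the
    two parts, so an infinite positive part would make it [+oo]. *)
Lemma integrable_ae_ge f g : measurable_fun setT f -> mu.-integrable setT g ->
  {ae mu, forall x, (g x <= f x)%E} -> (\int[mu]_x f x < +oo)%E ->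
  mu.-integrable setT f.
Proof.
move=> mf ig gf; have fn := integral_funeneg_lty mf ig gf.
rewrite integralE => fp; apply: integrable_funeposneg => //.
move: fp fn; have := @integral_ge0 _ _ _ mu setT f^\+%E (fun x _ => funepos_ge0 f x).
have := @integral_ge0 _ _ _ mu setT f^\-%E (fun x _ => funeneg_ge0 f x).
by case: (\int[mu]_x f^\+%E x)%E => [a| |]; case: (\int[mu]_x f^\-%E x)%E => [b| |] //=;
  rewrite ?ltry.
Qed.

Lemma integrable_ae_le f g : measurable_fun setT f -> mu.-integrable setT g ->
  {ae mu, forall x, (f x <= g x)%E} -> (-oo < \int[mu]_x f x)%E ->
  mu.-integrable setT f.
Proof.
move=> mf ig fg; have fp := integral_funepos_lty mf ig fg.
rewrite integralE => fn; apply: integrable_funeposneg => //.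
move: fn fp; have := @integral_ge0 _ _ _ mu setT f^\+%E (fun x _ => funepos_ge0 f x).
have := @integral_ge0 _ _ _ mu setT f^\-%E (fun x _ => funeneg_ge0 f x).
by case: (\int[mu]_x f^\+%E x)%E => [a| |]; case: (\int[mu]_x f^\-%E x)%E => [b| |] //=;
  rewrite ?ltry.
Qed.

Lemma integrable_ae_between f g h : measurable_fun setT f ->
  mu.-integrable setT g -> mu.-integrable setT h ->
  {ae mu, forall x, (g x <= f x)%E} -> {ae mu, forall x, (f x <= h x)%E} ->
  mu.-integrable setT f.
Proof.
move=> mf ig ih gf fh; apply: integrable_funeposneg => //.
- exact: integral_funepos_lty ih fh.
- exact: integral_funeneg_lty ig gf.
Qed.

(** For ordered functions the L1 distance is the difference of the integrals; monotonicity of the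
    integral and its equality case both follow from this. *)
Lemma integral_abseB_ae_le f g : mu.-integrable setT f -> mu.-integrable setT g ->
  {ae mu, forall x, (f x <= g x)%E} ->
  (\int[mu]_x `|g x - f x| = \int[mu]_x g x - \int[mu]_x f x)%E.
Proof.
move=> fi gi fg; rewrite -integralB//.
apply: ae_eq_integral => //.
- apply: measurableT_comp; first exact: abse_measurable.
  by apply: emeasurable_funB; [exact: measurable_int gi|exact: measurable_int fi].
- by apply: emeasurable_funB; [exact: measurable_int gi|exact: measurable_int fi].
have ff := integrable_ae measurableT fi.
move: fg ff; apply: filterS2 => x fg ff _.
by rewrite gee0_abs// sube_ge0 ?ff.
Qed.

Lemma ae_le_integral f g : mu.-integrable setT f -> mu.-integrable setT g ->
  {ae mu, forall x, (f x <= g x)%E} -> (\int[mu]_x f x <= \int[mu]_x g x)%E.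
Proof.
move=> fi gi fg.
rewrite -sube_ge0; last by rewrite integrable_fin_num.
by rewrite -integral_abseB_ae_le// integral_ge0.
Qed.

(** The L1 distance is zero. This is the uniqueness argument used twice: over outcomes at a fixed
    prompt, and over prompts. *)
Lemma ae_eq_of_le_integral f g : mu.-integrable setT f -> mu.-integrable setT g ->
  {ae mu, forall x, (f x <= g x)%E} -> (\int[mu]_x g x <= \int[mu]_x f x)%E ->
  {ae mu, forall x, f x = g x}.
Proof.
move=> fi gi fg gf.
have eqI : (\int[mu]_x g x = \int[mu]_x f x)%E.
  by apply/eqP; rewrite eq_le gf ae_le_integral.
have := integral_abseB_ae_le fi gi fg.
rewrite eqI subee; last by rewrite integrable_fin_num.
have mB : measurable_fun setT (fun x => g x - f x)%E.
  by apply: emeasurable_funB; [exact: measurable_int gi|exact: measurable_int fi].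
move/(ae_eq_integral_abs _ measurableT mB).
have ff := integrable_ae measurableT fi; have gfin := integrable_ae measurableT gi.
apply: filterS3 ff gfin => x /(_ Logic.I) ff /(_ Logic.I) gfin /(_ Logic.I) /eqP.
by rewrite sube_eq ?add0e ?fin_num_adde_defl// => /eqP.
Qed.

End ae_integral.

(** * Measurability of reciprocals, square roots and the divergence integrand *)

Section measurability.
Context {d : measure_display} {T : measurableType d} {R : realType}.
Implicit Types f g : T -> R.

(* [x^-1 = x * (x ^ 2)^-1], also at [0], reduces to a power of a nonnegative number. *)
Lemma measurable_funV f : measurable_fun setT f ->
  measurable_fun setT (fun x => (f x)^-1).
Proof.
move=> mf; rewrite (_ : (fun _ => _) = (fun x => f x * (f x ^+ 2) `^ (-1))).
  apply: measurable_funM => //.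
  apply: (measurableT_comp (measurable_powR _)).
  exact: measurable_funX.
apply/funext => x; rewrite powR_inv1 ?sqr_ge0// expr2.
have [->|fx] := eqVneq (f x) 0; first by rewrite invr0 mul0r.
by rewrite invfM mulrA divff// mul1r.
Qed.

Lemma measurable_fun_sqrt f : measurable_fun setT f ->
  measurable_fun setT (fun x => Num.sqrt (f x)).
Proof.
move=> mf; apply: (measurableT_comp _ mf).
by apply: nondecreasing_measurable => // x y xy; exact: ler_wsqrtr.
Qed.

Lemma measurable_KL_integrand f g : measurable_fun setT f -> measurable_fun setT g ->
  measurable_fun setT (fun x => KL_integrand (f x) (g x)).
Proof.
move=> mf mg; apply: measurable_fun_ifT => //.
  exact: measurable_fun_eqr.
apply: measurable_fun_ifT => //.
  exact: measurable_fun_eqr.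
apply/measurable_EFinP; apply: measurable_funM => //.
apply: (measurableT_comp (@measurable_ln _)).
apply: measurable_funM => //; exact: measurable_funV.
Qed.

End measurability.

(** * The Gibbs variational principle *)

Section pointwise.
Context {R : realType}.
Implicit Types (a b f x A K Z alpha beta : R).

Lemma ln_le_subr1 x : 0 < x -> ln x <= x - 1.
Proof.
by move=> x0; rewrite lerBrDl -{2}(lnK (x := x)) ?posrE// expR_ge1Dx.
Qed.

Lemma ln_eq_subr1 x : 0 < x -> (ln x == x - 1) = (x == 1).
Proof.
move=> x0; apply/idP/idP => [/eqP lnx|/eqP ->]; last by rewrite ln1 subrr.
rewrite -ln_eq0//; apply: contraT => /expR_gt1Dx.
by rewrite lnK ?posrE// lnx addrC subrK ltxx.
Qed.

(** The inequality [ln x <= x - 1] at [x = b / a]. For two densities the lower bound is integrable,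
    so the negative part of the integrand has a finite integral. *)
Lemma KL_integrand_ge a b : 0 <= a -> 0 <= b ->
  ((a - b)%:E <= KL_integrand a b)%E.
Proof.
move=> a0 b0; rewrite /KL_integrand; case: ifPn => [/eqP ->|an0].
  by rewrite lee_fin sub0r oppr_le0.
case: ifPn => [_|bn0]; first by rewrite leey.
have ap : 0 < a by rewrite lt_def an0.
have bp : 0 < b by rewrite lt_def bn0.
rewrite lee_fin -[a / b]invrK lnV ?posrE ?invr_gt0 ?divr_gt0// invf_div.
have : a * ln (b / a) <= a * (b / a - 1).
  by rewrite ler_pM2l// ln_le_subr1// divr_gt0.
have -> : a * (b / a - 1) = b - a by field.
by rewrite mulrN lerNr opprB.
Qed.

(** The log ratio is at most [K] where [a > 0], and [b = 0] forces [a = 0], which excludes the value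
    [+oo]. *)
Lemma KL_integrand_le K a b : 0 <= a -> 0 <= b -> a <= expR K * b ->
  (KL_integrand a b <= (K * a)%:E)%E.
Proof.
move=> a0 b0 aKb; rewrite /KL_integrand; case: ifPn => [/eqP ->|an0].
  by rewrite mulr0.
have ap : 0 < a by rewrite lt_def an0.
case: ifPn => [/eqP b_eq0|bn0].
  by move: aKb; rewrite b_eq0 mulr0 leNgt ap.
have bp : 0 < b by rewrite lt_def bn0.
rewrite lee_fin mulrC ler_pM2r// -(expRK K) ler_ln ?posrE ?expR_gt0 ?divr_gt0//.
by rewrite ler_pdivrMr.
Qed.

(** Replacing [b] by its bound recombines the powers of [a] into [a] and leaves the factor
    [expR (K * (1 - alpha))], at most [expR K]. *)
Lemma powR_mix_le alpha K a b : 0 < alpha < 1 -> 0 <= K -> 0 <= a -> 0 <= b ->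
  b <= expR K * a -> a `^ alpha * b `^ (1 - alpha) <= expR K * a.
Proof.
move=> /andP[al0 al1] K0 a0 b0 ba.
have a'0 : 0 <= 1 - alpha by rewrite subr_ge0 ltW.
apply: (@le_trans _ _ (a `^ alpha * (expR K * a) `^ (1 - alpha))).
  rewrite ler_wpM2l ?powR_ge0// ge0_ler_powR// ?nnegrE//.
  by rewrite mulr_ge0// expR_ge0.
rewrite powRM ?expR_ge0// mulrCA -powRD; last by rewrite addrC subrK oner_eq0.
rewrite [alpha + _]addrC subrK powRr1// ler_wpM2r// -expRM ler_expR.
by rewrite ler_piMr// gerBl ltW.
Qed.

Lemma powR_mix_ge alpha K a b : 0 < alpha < 1 -> 0 <= K -> 0 <= a -> 0 <= b ->
  expR (- K) * a <= b -> expR (- K) * a <= a `^ alpha * b `^ (1 - alpha).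
Proof.
move=> /andP[al0 al1] K0 a0 b0 ba.
have a'0 : 0 <= 1 - alpha by rewrite subr_ge0 ltW.
apply: (@le_trans _ _ (a `^ alpha * (expR (- K) * a) `^ (1 - alpha))); last first.
  rewrite ler_wpM2l ?powR_ge0// ge0_ler_powR// ?nnegrE//.
  by rewrite mulr_ge0// expR_ge0.
rewrite powRM ?expR_ge0// mulrCA -powRD; last by rewrite addrC subrK oner_eq0.
rewrite [alpha + _]addrC subrK powRr1// ler_wpM2r// -expRM ler_expR.
by rewrite mulNr lerN2 ler_piMr// gerBl ltW.
Qed.

Definition gibbs_weight alpha beta A a b : R :=
  a `^ alpha * b `^ (1 - alpha) * expR (A / beta).

(** The integrand of the inner objective, with the divergences under the same integral as the
    advantage. *)
Definition kl_gain alpha beta A a b f : \bar R :=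
  ((f * A)%:E -
   beta%:E * (alpha%:E * KL_integrand f a + (1 - alpha)%:E * KL_integrand f b))%E.

(* With x = w / (Z f), the gap between the two sides is beta f (x - 1 - ln x). *)
Lemma kl_gain_le_eq alpha beta A a b f Z : 0 < alpha < 1 -> 0 < beta -> 0 < Z ->
  0 <= a -> 0 <= b -> (a == 0) = (b == 0) -> 0 <= f ->
  let w := gibbs_weight alpha beta A a b in
  let u := (beta * (f * ln Z - f + w / Z))%:E in
  (kl_gain alpha beta A a b f <= u)%E /\
  (kl_gain alpha beta A a b f == u) = (f == w / Z).
Proof.
move=> /andP[al0 al1] be0 Z0 a0 b0 ab f0 w u.
have al1' : 0 < 1 - alpha by rewrite subr_gt0.
have w0 : 0 <= w by rewrite !mulr_ge0 ?powR_ge0 ?expR_ge0.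
rewrite /u /kl_gain /KL_integrand; have [->|fn0] := eqVneq f 0.
  rewrite !mul0r !mule0 adde0 mule0 oppe0 adde0 subrr add0r; split.
    by rewrite lee_fin mulr_ge0 ?divr_ge0// ltW.
  by rewrite eqe [_ == beta * _]eq_sym mulf_eq0 gt_eqF//= eq_sym.
have fp : 0 < f by rewrite lt_def fn0.
(* If [a = 0] then [b = 0], so both divergence terms are [+oo] and the gain is [-oo]; since [w = 0]
   and [f] is nonzero, both equalities fail. *)
rewrite -ab; have [a_eq0|an0] := eqVneq a 0.
  rewrite !gt0_muley ?lte_fin//; split; first exact: leNye.
  have -> : w = 0 by rewrite /w /gibbs_weight a_eq0 powR0 ?gt_eqF// !mul0r.
  by rewrite mul0r (negbTE fn0).
have ap : 0 < a by rewrite lt_def an0.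
have bp : 0 < b by rewrite lt_def -ab an0.
have wp : 0 < w by rewrite !mulr_gt0 ?powR_gt0 ?expR_gt0.
pose x := w / Z / f.
have xp : 0 < x by rewrite !divr_gt0.
have lnx : ln x = alpha * ln a + (1 - alpha) * ln b + A / beta - ln Z - ln f.
  rewrite /x !ln_div ?posrE ?divr_gt0// /w /gibbs_weight.
  by rewrite !lnM ?posrE ?mulr_gt0 ?powR_gt0 ?expR_gt0// !ln_powR expRK.
have wfx : w / Z = f * x by rewrite /x mulrCA divff// mulr1.
rewrite wfx -[X in X == f * x]mulr1 (inj_eq (mulfI fn0)) [1 == x]eq_sym.
rewrite !ln_div ?posrE//.
set k := (k in (k <= _)%E).
have -> : k = (f * A - beta * (alpha * (f * (ln f - ln a)) +
    (1 - alpha) * (f * (ln f - ln b))))%:E by [].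
rewrite lee_fin eqe -subr_ge0 [_ == beta * _]eq_sym -[X in _ /\ X = _]subr_eq0.
have -> : beta * (f * ln Z - f + f * x) -
    (f * A - beta * (alpha * (f * (ln f - ln a)) + (1 - alpha) * (f * (ln f - ln b)))) =
    beta * f * (x - 1 - ln x).
  (* Eliminating [A] in favour of [ln x] leaves a polynomial identity. *)
  have -> : A = beta * (A / beta) by rewrite mulrCA divff ?gt_eqF// mulr1.
  have -> : A / beta = ln x - (alpha * ln a + (1 - alpha) * ln b - ln Z - ln f).
    by rewrite lnx; ring.
  ring.
split; first by rewrite mulr_ge0 ?subr_ge0 ?ln_le_subr1// mulr_ge0// ltW.
by rewrite !mulf_eq0 (gt_eqF be0) (gt_eqF fp)/= subr_eq0 eq_sym ln_eq_subr1.
Qed.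

End pointwise.

(** * The inner maximization at a fixed prompt *)

Section gibbs_variational.
Context {d : measure_display} {O : measurableType d} {R : realType}.
Variable mu : {measure set O -> \bar R}.
Implicit Types a b f A : O -> R.

Definition is_density f : Prop :=
  [/\ measurable_fun setT f, forall o, 0 <= f o & (\int[mu]_o (f o)%:E = 1)%E].

(** The constants are exponentials so that they add when bounds are chained. *)
Definition comparable_density (K : R) a b : Prop :=
  {ae mu, forall o, expR (- K) * a o <= b o <= expR K * a o}.

Lemma density_integrable f : is_density f -> mu.-integrable setT (EFin \o f).
Proof.
move=> [mf f0 f1]; apply/integrableP; split; first exact/measurable_EFinP.
rewrite (eq_integral (EFin \o f)) ?f1 ?ltry// => o _ /=.
by rewrite ger0_norm.
Qed.

Lemma density_integrableZ k f : is_density f ->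
  mu.-integrable setT (fun o => (k * f o)%:E).
Proof. by move=> /density_integrable/(integrableZl measurableT k). Qed.

Lemma density_integralZ k f : is_density f -> (\int[mu]_o (k * f o)%:E = k%:E)%E.
Proof.
move=> df; have [_ _ f1] := df.
under eq_integral do rewrite EFinM.
by rewrite integralZl ?f1 ?mule1//; exact: density_integrable.
Qed.

Lemma integrable_KL f a : is_density f -> is_density a -> (KL mu f a < +oo)%E ->
  mu.-integrable setT (fun o => KL_integrand (f o) (a o)).
Proof.
move=> df da; have [[mf f0 _] [ma a0 _]] := (df, da).
apply: (integrable_ae_ge (measurable_KL_integrand mf ma)
  (integrableB measurableT (density_integrable df) (density_integrable da))).
by apply: aeW => o; exact: KL_integrand_ge.
Qed.

(** Excludes the sum [+oo + -oo], so that one infinite divergence makes the whole penalty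
    infinite. *)
Lemma KL_gtNy f a : is_density f -> is_density a -> (-oo < KL mu f a)%E.
Proof.
move=> df da; have [ly|] := ltP (KL mu f a) +oo%E.
  have /(integrable_fin_num measurableT) := integrable_KL df da ly.
  by rewrite fin_numElt => /andP[].
exact: lt_le_trans.
Qed.

Lemma integrable_KL_comparable K f a : is_density f -> is_density a ->
  comparable_density K a f -> mu.-integrable setT (fun o => KL_integrand (f o) (a o)).
Proof.
move=> df da fa; have [[mf f0 _] [ma a0 _]] := (df, da).
apply: (integrable_ae_between (measurable_KL_integrand mf ma)
  (integrableB measurableT (density_integrable df) (density_integrable da))
  (density_integrableZ K df)).
- by apply: aeW => o; exact: KL_integrand_ge.
- by apply: filterS fa => o /andP[_ fa]; exact: KL_integrand_le.
Qed.

(** The inner objective at one prompt, written so that [objective] is its integral over prompts by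
    conversion. *)
Definition expected_gain alpha beta A a b f : \bar R :=
  (\int[mu]_o (f o * A o)%:E -
   beta%:E * (alpha%:E * KL mu f a + (1 - alpha)%:E * KL mu f b))%E.

Variables (alpha beta K M : R) (A a b : O -> R).
Hypotheses (halpha : 0 < alpha < 1) (hbeta : 0 < beta) (K0 : 0 <= K).
Hypotheses (mA : measurable_fun setT A) (hA : forall o, `|A o| <= M).
Hypotheses (da : is_density a) (db : is_density b) (hab : comparable_density K a b).

Let w o : R := gibbs_weight alpha beta (A o) (a o) (b o).
Let Z : R := fine (\int[mu]_o (w o)%:E).
Let L : R := K + M / beta.

Lemma measurable_gibbs_weight : measurable_fun setT w.
Proof.
have [[ma _ _] [mb _ _]] := (da, db).
apply: measurable_funM.
  by apply: measurable_funM; [exact: measurableT_comp (measurable_powR _) ma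
    |exact: measurableT_comp (measurable_powR _) mb].
apply: (measurableT_comp (@measurable_expR _)).
exact: measurable_funM.
Qed.

Lemma gibbs_weight_ge0 o : 0 <= w o.
Proof. by rewrite !mulr_ge0 ?powR_ge0 ?expR_ge0. Qed.

(** In [L], the geometric mean accounts for [K] and the factor [expR (A / beta)] for [M / beta]. *)
Lemma gibbs_weight_comparable : comparable_density L a w.
Proof.
have [[_ a0 _] [_ b0 _]] := (da, db).
apply: filterS hab => o /andP[ab ba]; rewrite /w /gibbs_weight.
have /ler_normlP[A1 A2] := hA o.
have eA1 : expR (- (M / beta)) <= expR (A o / beta).
  by rewrite ler_expR -mulNr ler_pM2r ?invr_gt0// lerNl.
have eA2 : expR (A o / beta) <= expR (M / beta).
  by rewrite ler_expR ler_pM2r ?invr_gt0.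
apply/andP; split.
  by rewrite /L opprD expRD mulrAC ler_pM ?mulr_ge0 ?expR_ge0 ?powR_mix_ge.
by rewrite /L expRD [leRHS]mulrAC ler_pM ?mulr_ge0 ?powR_ge0 ?expR_ge0 ?powR_mix_le.
Qed.

Lemma integrable_gibbs_weight : mu.-integrable setT (EFin \o w).
Proof.
apply: (integrable_ae_between _ (density_integrableZ (expR (- L)) da)
  (density_integrableZ (expR L) da)).
- exact/measurable_EFinP/measurable_gibbs_weight.
- by apply: filterS gibbs_weight_comparable => o /andP[]; rewrite lee_fin.
- by apply: filterS gibbs_weight_comparable => o /andP[]; rewrite lee_fin.
Qed.

Lemma gibbs_partitionE : (\int[mu]_o (w o)%:E = Z%:E)%E.
Proof.
by rewrite /Z fineK//; exact: integrable_fin_num integrable_gibbs_weight.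
Qed.

(** The bounds on [w] are integrated against [a], which has mass 1. *)
Lemma gibbs_partition_bounds : expR (- L) <= Z <= expR L.
Proof.
have iw := integrable_gibbs_weight; rewrite -!lee_fin -gibbs_partitionE.
apply/andP; split.
  rewrite -(density_integralZ (expR (- L)) da).
  apply: (ae_le_integral (density_integrableZ _ da) iw).
  by apply: filterS gibbs_weight_comparable => o /andP[]; rewrite lee_fin.
rewrite -(density_integralZ (expR L) da).
apply: (ae_le_integral iw (density_integrableZ _ da)).
by apply: filterS gibbs_weight_comparable => o /andP[]; rewrite lee_fin.
Qed.

Lemma gibbs_partition_gt0 : 0 < Z.
Proof.
by have /andP[+ _] := gibbs_partition_bounds; apply: lt_le_trans; exact: expR_gt0.
Qed.

Lemma is_density_gibbs : is_density (fun o => w o / Z).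
Proof.
have Z0 := gibbs_partition_gt0; split.
- by apply: measurable_funM => //; exact: measurable_gibbs_weight.
- by move=> o; rewrite divr_ge0 ?gibbs_weight_ge0// ltW.
- under eq_integral do rewrite mulrC EFinM.
  rewrite integralZl//; last exact: integrable_gibbs_weight.
  by rewrite gibbs_partitionE -EFinM mulVf// gt_eqF.
Qed.

(** The weight and the normalization [Z^-1] contribute [L] each. *)
Lemma gibbs_comparable : comparable_density (L + L) a (fun o => w o / Z).
Proof.
have [_ a0 _] := da; have Z0 := gibbs_partition_gt0.
have /andP[ZL LZ] := gibbs_partition_bounds.
have LV : expR (- L) <= Z^-1 by rewrite expRN lef_pV2 ?posrE ?expR_gt0.
have VL : Z^-1 <= expR L.
  by rewrite -[expR L]invrK -expRN lef_pV2 ?posrE ?expR_gt0.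
apply: filterS gibbs_weight_comparable => o /andP[wL Lw].
apply/andP; split.
  by rewrite opprD expRD mulrAC ler_pM ?mulr_ge0 ?expR_ge0.
by rewrite expRD [leRHS]mulrAC ler_pM ?gibbs_weight_ge0 ?invr_ge0 ?(ltW Z0).
Qed.

(** Multiplicative bounds preserve zeros in both directions; this supplies the hypothesis on zeros
    in [kl_gain_le_eq]. *)
Lemma comparable_eq0 :
  {ae mu, forall o, (a o == 0) = (b o == 0)}.
Proof.
have [[_ a0 _] [_ b0 _]] := (da, db).
apply: filterS hab => o /andP[ab ba]; apply/eqP/eqP => [ao|bo].
  by apply/eqP; rewrite eq_le b0 andbT (le_trans ba)// ao mulr0.
by apply/eqP; rewrite eq_le a0 andbT -(pmulr_rle0 _ (expR_gt0 (- K))) -bo.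
Qed.

Lemma integrable_gain f : is_density f -> mu.-integrable setT (fun o => (f o * A o)%:E).
Proof.
move=> df; have [mf f0 _] := df.
(* The type [O] is pointed, so the bound on [A] can be read at [point]. *)
have M0 : 0 <= M by rewrite (le_trans _ (hA point)).
apply: (le_integrable measurableT _ _ (density_integrableZ M df)).
  by apply/measurable_EFinP; exact: measurable_funM.
move=> o _ /=; rewrite lee_fin !normrM [leRHS]mulrC ler_wpM2l//.
by rewrite (le_trans (hA o))// ler_norm.
Qed.

Lemma kl_gain_integral f : is_density f ->
  mu.-integrable setT (fun o => KL_integrand (f o) (a o)) ->
  mu.-integrable setT (fun o => KL_integrand (f o) (b o)) ->
  mu.-integrable setT (fun o => kl_gain alpha beta (A o) (a o) (b o) (f o)) /\
  expected_gain alpha beta A a b f =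
  (\int[mu]_o kl_gain alpha beta (A o) (a o) (b o) (f o))%E.
Proof.
move=> df ia ib; have iA := integrable_gain df.
have ia' := integrableZl measurableT alpha ia.
have ib' := integrableZl measurableT (1 - alpha) ib.
have iab := integrableZl measurableT beta (integrableD measurableT ia' ib').
split; first exact: integrableB.
rewrite /expected_gain /kl_gain integralB// integralZl//; last exact: integrableD.
by rewrite integralD// !integralZl.
Qed.

(** A divergence with non-integrable integrand is [+oo], the other one is not [-oo], both weights
    are positive and the advantage term is finite. *)
Lemma expected_gain_Ny f : is_density f -> 
  ~ mu.-integrable setT (fun o => KL_integrand (f o) (a o)) \/
  ~ mu.-integrable setT (fun o => KL_integrand (f o) (b o)) ->
  expected_gain alpha beta A a b f = -oo%E.
Proof.
move=> df nab; have /andP[al0 al1] := halpha.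
have [aN bN] := (KL_gtNy df da, KL_gtNy df db).
have := integrable_fin_num measurableT (integrable_gain df).
rewrite /expected_gain.
have : KL mu f a = +oo%E \/ KL mu f b = +oo%E.
  case: nab => nab; [left|right]; apply/eqP; rewrite eq_le leey/= leNgt;
    by apply/negP => /integrable_KL; move/(_ _ _)/nab; apply.
have al1' : 0 < 1 - alpha by rewrite subr_gt0.
move: aN bN; case: (KL mu f a) => [x| |]; case: (KL mu f b) => [y| |] // _ _ [] // _;
  rewrite ?gt0_muley ?lte_fin//; case: (\int[mu]_o _)%E => //.
Qed.

Let u f o : \bar R := (beta * (f o * ln Z - f o + w o / Z))%:E.

(** The terms [- f] and [w / Z] have integrals -1 and 1, which cancel: the bound is the same for
    every density. *)
Lemma gibbs_bound_integral f : is_density f ->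
  mu.-integrable setT (u f) /\ (\int[mu]_o u f o = (beta * ln Z)%:E)%E.
Proof.
move=> df; have dg := is_density_gibbs.
have i1 := density_integrableZ (beta * (ln Z - 1)) df.
have i2 := density_integrableZ beta dg.
have uE : u f = (fun o => (beta * (ln Z - 1) * f o)%:E + (beta * (w o / Z))%:E)%E.
  by apply/funext => o; rewrite /u -EFinD; congr EFin; ring.
rewrite uE; split; first exact: integrableD.
rewrite integralD// !density_integralZ// -EFinD; congr EFin; ring.
Qed.

Lemma kl_gain_le_ae f : is_density f ->
  {ae mu, forall o, (kl_gain alpha beta (A o) (a o) (b o) (f o) <= u f o)%E /\
    (kl_gain alpha beta (A o) (a o) (b o) (f o) == u f o) = (f o == w o / Z)}.
Proof.
move=> [_ f0 _]; have [[_ a0 _] [_ b0 _]] := (da, db).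
apply: filterS comparable_eq0 => o ab.
by apply: kl_gain_le_eq => //; exact: gibbs_partition_gt0.
Qed.

Lemma expected_gain_le f : is_density f ->
  (expected_gain alpha beta A a b f <= (beta * ln Z)%:E)%E.
Proof.
move=> df; have [iu <-] := gibbs_bound_integral df.
have [[ia ib]|/not_andP/expected_gain_Ny->//] := EM
  (mu.-integrable setT (fun o => KL_integrand (f o) (a o)) /\
   mu.-integrable setT (fun o => KL_integrand (f o) (b o))); last exact: leNye.
have [iH ->] := kl_gain_integral df ia ib.
apply: ae_le_integral => //.
by apply: filterS (kl_gain_le_ae df) => o [].
Qed.

(** A finite gain makes both divergences integrable; equal integrals of ordered functions then put
    almost every outcome in the equality case of the pointwise bound. *)
Lemma expected_gain_eq f : is_density f ->
  expected_gain alpha beta A a b f = (beta * ln Z)%:E ->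
  {ae mu, forall o, f o = w o / Z}.
Proof.
move=> df; have [iu <-] := gibbs_bound_integral df.
have [[ia ib]|/not_andP/expected_gain_Ny->//] := EM
  (mu.-integrable setT (fun o => KL_integrand (f o) (a o)) /\
   mu.-integrable setT (fun o => KL_integrand (f o) (b o))); last first.
  by have := integrable_fin_num measurableT iu; case: (\int[mu]_o _)%E.
have [iH ->] := kl_gain_integral df ia ib => Hu.
have le_Hu : {ae mu, forall o, (kl_gain alpha beta (A o) (a o) (b o) (f o) <= u f o)%E}.
  by apply: filterS (kl_gain_le_ae df) => o [].
have eq_Hu := ae_eq_of_le_integral iH iu le_Hu.
rewrite Hu in eq_Hu; have {}eq_Hu := eq_Hu (lexx _).
by apply: filterS2 eq_Hu (kl_gain_le_ae df) => o Hu' [_]; rewrite Hu' eqxx => /esym/eqP.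
Qed.

Lemma expected_gain_gibbs :
  expected_gain alpha beta A a b (fun o => w o / Z) = (beta * ln Z)%:E.
Proof.
have dg := is_density_gibbs; have [iu <-] := gibbs_bound_integral dg.
have ia := integrable_KL_comparable dg da gibbs_comparable.
have [[ma a0 _] [mb b0 _]] := (da, db); have [mg g0 _] := dg.
have ib : mu.-integrable setT (fun o => KL_integrand (w o / Z) (b o)).
  (* Comparison with [b] passes through [a]: [L + L] for the Gibbs density against [a], then [K] for
     [a] against [b]. *)
  apply: (@integrable_KL_comparable (L + L + K)) => //.
  apply: filterS2 hab gibbs_comparable => o /andP[ab ba] /andP[ag ga].
  have bKa : expR (- K) * b o <= a o.
    by rewrite expRN mulrC ler_pdivrMr ?expR_gt0// mulrC.
  have aKb : a o <= expR K * b o.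
    by rewrite -ler_pdivrMl ?expR_gt0// -expRN.
  apply/andP; split.
    rewrite opprD expRD -mulrA; apply: le_trans (ler_wpM2l _ bKa) ag.
    exact: expR_ge0.
  rewrite expRD -mulrA; apply: le_trans ga (ler_wpM2l _ aKb).
  exact: expR_ge0.
have [iH ->] := kl_gain_integral dg ia ib.
apply: ae_eq_integral => //; [exact: measurable_int iH|exact: measurable_int iu|].
by apply: filterS (kl_gain_le_ae dg) => o [_]; rewrite eqxx => /eqP Hu _.
Qed.

End gibbs_variational.

(** * Maximizers of the expected objective *)

Section argmax.
Context {dQ dO : measure_display}.
Context {Q : measurableType dQ} {O : measurableType dO} {R : realType}.
Variables (rho : probability Q R) (mu : {sigma_finite_measure set O -> \bar R}).
Variable r : Q -> O -> bool.
Hypothesis hr : measurable_fun [set: Q * O] (fun x : Q * O => r x.1 x.2).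
Implicit Types pi : Q -> O -> R.

(** Tonelli's theorem gives the measurability for nonnegative integrands; it is applied to the
    positive and negative parts. *)
Lemma measurable_integral_section (F : Q * O -> \bar R) :
  measurable_fun setT F -> measurable_fun setT (fun q => \int[mu]_o F (q, o))%E.
Proof.
move=> mF; under eq_fun do rewrite integralE.
apply: emeasurable_funB.
  rewrite (_ : (fun _ => _) = fubini_F mu F^\+%E).
    by apply: measurable_fun_fubini_tonelli_F => //; exact: measurable_funepos.
  by apply/funext => q; apply: eq_integral => o _; rewrite !funeposE.
rewrite (_ : (fun _ => _) = fubini_F mu F^\-%E).
  by apply: measurable_fun_fubini_tonelli_F => //; exact: measurable_funeneg.
by apply/funext => q; apply: eq_integral => o _; rewrite !funenegE.
Qed.

Lemma policy_density pi q : is_policy mu pi -> is_density mu (pi q).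
Proof.
by move=> [mpi pi0 pi1]; split => //; exact: (measurable_fun_pair2 q mpi).
Qed.

Lemma measurable_rewardR : measurable_fun [set: Q * O] (fun x => (r x.1 x.2)%:R : R).
Proof.
rewrite (_ : (fun _ => _) = (fun x => if r x.1 x.2 then 1 else 0)).
  exact: measurable_fun_ifT.
by apply/funext => x; case: (r _ _).
Qed.

(** Trades the domain, which varies with [q], for an indicator factor, so that joint measurability
    applies. *)
Lemma psuccE pi q : psucc mu r pi q = fine (\int[mu]_o (pi q o * (r q o)%:R)%:E)%E.
Proof.
rewrite /psucc /Rintegral integral_mkcond; congr fine.
apply: eq_integral => o _; rewrite patchE; case: (boolP (r q o)) => ro.
  by rewrite mem_set// mulr1.
by rewrite memNset ?mulr0//; apply/negP.
Qed.

Lemma measurable_psucc pi : is_policy mu pi -> measurable_fun setT (psucc mu r pi).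
Proof.
move=> [mpi _ _]; rewrite (_ : psucc mu r pi = fun q =>
    fine (\int[mu]_o (pi q o * (r q o)%:R)%:E)%E); last first.
  by apply/funext => q; exact: psuccE.
apply: measurableT_comp => //; apply: (@measurable_integral_section
  (fun x => (pi x.1 x.2 * (r x.1 x.2)%:R)%:E)).
by apply/measurable_EFinP; apply: measurable_funM => //; exact: measurable_rewardR.
Qed.

Lemma psucc_bounds pi q : is_policy mu pi -> 0 <= psucc mu r pi q <= 1.
Proof.
move=> ppi; have [mf f0 f1] := policy_density q ppi.
have pos o : (0 <= (pi q o * (r q o)%:R)%:E)%E by rewrite lee_fin mulr_ge0.
have le1 : (\int[mu]_o (pi q o * (r q o)%:R)%:E <= 1)%E.
  rewrite -f1; apply: ge0_le_integral => //.
  - apply/measurable_EFinP; apply: measurable_funM => //.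
    exact: (measurable_fun_pair2 q measurable_rewardR).
  - exact/measurable_EFinP.
  - by move=> o _; rewrite lee_fin ler_piMr//; case: (r q o).
have ge0 : (0 <= \int[mu]_o (pi q o * (r q o)%:R)%:E)%E by exact: integral_ge0.
rewrite psuccE -!lee_fin fineK ?ge0//.
by rewrite ge0_fin_numE// (le_lt_trans le1)// ltry.
Qed.

Lemma measurable_advantage eps pi : is_policy mu pi ->
  measurable_fun [set: Q * O] (fun x => advantage mu r eps pi x.1 x.2).
Proof.
move=> ppi.
have mp : measurable_fun [set: Q * O] (fun x => psucc mu r pi x.1).
  exact: measurableT_comp (measurable_psucc ppi) _.
have m1p : measurable_fun [set: Q * O] (fun x => 1 - psucc mu r pi x.1).
  exact: measurable_funB.
have mS : measurable_fun [set: Q * O]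
    (fun x => (Num.sqrt (psucc mu r pi x.1 * (1 - psucc mu r pi x.1) + eps))^-1).
  apply: measurable_funV; apply: measurable_fun_sqrt.
  by apply: measurable_funD => //; exact: measurable_funM.
apply: measurable_fun_ifT => //; first exact: measurable_funM.
by apply: measurable_funN; exact: measurable_funM.
Qed.

(** Both numerators lie between 0 and 1 and the denominator is at least [Num.sqrt eps]. The bound
    does not depend on [q], which keeps the comparability constants uniform. *)
Lemma advantage_bounded eps pi q o : 0 < eps -> is_policy mu pi ->
  `|advantage mu r eps pi q o| <= (Num.sqrt eps)^-1.
Proof.
move=> eps0 ppi; have /andP[] := psucc_bounds q ppi.
rewrite /advantage /omega_plus /omega_minus; set p := psucc _ _ _ _ => p0 p1.
have s0 : 0 < Num.sqrt eps by rewrite sqrtr_gt0.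
have p1' : 0 <= 1 - p by rewrite subr_ge0.
have sle : Num.sqrt eps <= Num.sqrt (p * (1 - p) + eps).
  by rewrite ler_wsqrtr// lerDr mulr_ge0.
have sV : (Num.sqrt (p * (1 - p) + eps))^-1 <= (Num.sqrt eps)^-1.
  by rewrite lef_pV2 ?posrE// (lt_le_trans s0).
have sV0 : 0 <= (Num.sqrt (p * (1 - p) + eps))^-1 by rewrite invr_ge0 sqrtr_ge0.
case: ifP => _; rewrite ?normrN ger0_norm ?mulr_ge0//; apply: le_trans sV.
  by rewrite ler_piMl// gerBl.
by rewrite ler_piMl.
Qed.

(** * One step of the policy recursion *)

Section step.
Variables (alpha beta eps : R) (piref piold : Q -> O -> R).
Hypotheses (halpha : 0 < alpha < 1) (hbeta : 0 < beta) (heps : 0 < eps).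
Hypotheses (pref : is_policy mu piref) (pold : is_policy mu piold).

Definition policy_weight q o : R :=
  gibbs_weight alpha beta (advantage mu r eps piold q o) (piref q o) (piold q o).

Definition policy_partition q : R := fine (\int[mu]_o (policy_weight q o)%:E).

(* Falling back to the reference makes this a policy at every q. *)
Definition gibbs_policy q o : R :=
  if 0 < policy_partition q then policy_weight q o / policy_partition q
  else piref q o.

Definition policy_gain pi q : \bar R :=
  expected_gain mu alpha beta (advantage mu r eps piold q) (piref q) (piold q) (pi q).

Lemma objectiveE pi :
  objective rho mu r alpha beta eps piref piold pi = (\int[rho]_q policy_gain pi q)%E.
Proof. by []. Qed.

Lemma measurable_policy_weight :
  measurable_fun [set: Q * O] (fun x => policy_weight x.1 x.2).
Proof.
have [[ma _ _] [mb _ _]] := (pref, pold).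
apply: measurable_funM.
  by apply: measurable_funM; [exact: measurableT_comp (measurable_powR _) ma
    |exact: measurableT_comp (measurable_powR _) mb].
apply: (measurableT_comp (@measurable_expR _)).
by apply: measurable_funM => //; exact: measurable_advantage.
Qed.

Lemma measurable_policy_partition : measurable_fun setT policy_partition.
Proof.
apply: measurableT_comp => //; apply: (@measurable_integral_section
  (fun x => (policy_weight x.1 x.2)%:E)).
by apply/measurable_EFinP; exact: measurable_policy_weight.
Qed.

Lemma is_policy_gibbs : is_policy mu gibbs_policy.
Proof.
have [ma a0 a1] := pref; have mw := measurable_policy_weight.
have mZ : measurable_fun [set: Q * O] (fun x => policy_partition x.1).
  exact: measurableT_comp measurable_policy_partition _.
have w0 q o : 0 <= policy_weight q o by rewrite !mulr_ge0 ?powR_ge0 ?expR_ge0.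
split.
- apply: measurable_fun_ifT => //; first exact: measurable_fun_ltr.
  by apply: measurable_funM => //; exact: measurable_funV.
- move=> q o; rewrite /gibbs_policy; case: ifPn => // Z0.
  by rewrite divr_ge0// ltW.
- move=> q; rewrite /gibbs_policy.
  have [Z0|Z0] := ltP 0 (policy_partition q); last exact: a1.
  rewrite (eq_integral (fun o => ((policy_partition q)^-1)%:E * (policy_weight q o)%:E)%E);
    last by move=> o _; rewrite -EFinM mulrC.
  have mwq : measurable_fun setT (fun o => (policy_weight q o)%:E).
    by apply/measurable_EFinP; exact: (measurable_fun_pair2 q mw).
  rewrite ge0_integralZl_EFin ?invr_ge0 ?(ltW Z0)//; last first.
    by move=> o _; rewrite lee_fin.
  (* Since [fine] sends infinite values to 0, a positive partition function is a genuine finite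
     integral. *)
  move: Z0; rewrite /policy_partition; case: (\int[mu]_o _)%E => [z| |]/=; rewrite ?ltxx//.
  by move=> z0; rewrite -EFinM mulVf// gt_eqF.
Qed.

Lemma measurable_policy_gain pi : is_policy mu pi ->
  measurable_fun setT (policy_gain pi).
Proof.
move=> [mpi _ _]; have [[ma _ _] [mb _ _]] := (pref, pold).
have mKL f : measurable_fun [set: Q * O] (fun x => f x.1 x.2) ->
    measurable_fun setT (fun q => KL mu (pi q) (f q)).
  move=> mf; apply: (@measurable_integral_section
    (fun x => KL_integrand (pi x.1 x.2) (f x.1 x.2))).
  exact: measurable_KL_integrand.
apply: emeasurable_funB.
  apply: (@measurable_integral_section
    (fun x => (pi x.1 x.2 * advantage mu r eps piold x.1 x.2)%:E)).
  apply/measurable_EFinP; apply: measurable_funM => //.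
  exact: measurable_advantage.
apply: emeasurable_funM => //; apply: emeasurable_funD;
  by apply: emeasurable_funM => //; exact: mKL.
Qed.

Variable K : R.
Hypothesis K0 : 0 <= K.
Hypothesis hK : {ae rho, forall q, comparable_density mu K (piref q) (piold q)}.

Let L : R := K + (Num.sqrt eps)^-1 / beta.

Lemma policy_partition_bounds q : comparable_density mu K (piref q) (piold q) ->
  expR (- L) <= policy_partition q <= expR L.
Proof.
move=> hq; apply: (gibbs_partition_bounds halpha hbeta K0 _ _ _ _ hq).
- exact: (measurable_fun_pair2 q (measurable_advantage eps pold)).
- by move=> o; exact: advantage_bounded.
- exact: policy_density.
- exact: policy_density.
Qed.

Lemma policy_gain_le pi q : is_policy mu pi ->
  comparable_density mu K (piref q) (piold q) ->
  (policy_gain pi q <= (beta * ln (policy_partition q))%:E)%E.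
Proof.
move=> ppi hq; apply: (expected_gain_le halpha hbeta K0 _ _ _ _ hq).
- exact: (measurable_fun_pair2 q (measurable_advantage eps pold)).
- by move=> o; exact: advantage_bounded.
- exact: policy_density.
- exact: policy_density.
- exact: policy_density.
Qed.

Lemma policy_gain_gibbs q : comparable_density mu K (piref q) (piold q) ->
  policy_gain gibbs_policy q = (beta * ln (policy_partition q))%:E.
Proof.
move=> hq; have /andP[Z0 _] := policy_partition_bounds hq.
(* Comparability makes the partition function positive, so the fallback branch is not taken at this
   [q]. *)
rewrite /policy_gain (_ : gibbs_policy q =
    fun o => policy_weight q o / policy_partition q); last first.
  by apply/funext => o; rewrite /gibbs_policy (lt_le_trans (expR_gt0 _) Z0).
apply: (expected_gain_gibbs halpha hbeta K0 _ _ _ _ hq).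
- exact: (measurable_fun_pair2 q (measurable_advantage eps pold)).
- by move=> o; exact: advantage_bounded.
- exact: policy_density.
- exact: policy_density.
Qed.

(** For almost every prompt the gain lies between [- (beta * L)] and [beta * L], and [rho] is a
    finite measure. *)
Lemma integrable_policy_gain_gibbs : rho.-integrable setT (policy_gain gibbs_policy).
Proof.
have cst_int c : rho.-integrable setT (fun=> (c : R)%:E).
  exact: finite_measure_integrable_cst.
apply: (integrable_ae_between (measurable_policy_gain is_policy_gibbs)
  (cst_int (beta * - L)) (cst_int (beta * L))); apply: filterS hK => q hq;
  rewrite policy_gain_gibbs// lee_fin ler_pM2l//;
  have /andP[LZ ZL] := policy_partition_bounds hq.
- by rewrite -(expRK (- L)) ler_ln ?posrE ?expR_gt0// (lt_le_trans _ LZ) ?expR_gt0.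
- by rewrite -(expRK L) ler_ln ?posrE ?expR_gt0// (lt_le_trans _ LZ) ?expR_gt0.
Qed.

(** The Gibbs policy is best at almost every prompt, while optimality of [pi] orders the integrals
    the other way: the gains agree almost everywhere, and uniqueness at each prompt concludes. *)
Lemma argmax_gibbs pi :
  is_argmax mu (objective rho mu r alpha beta eps piref piold) pi ->
  {ae rho, forall q, {ae mu, forall o,
    pi q o = policy_weight q o / policy_partition q}}.
Proof.
move=> [ppi /(_ _ is_policy_gibbs)]; rewrite !objectiveE => Jle.
have ig := integrable_policy_gain_gibbs.
have le_gain : {ae rho, forall q, (policy_gain pi q <= policy_gain gibbs_policy q)%E}.
  by apply: filterS hK => q hq; rewrite policy_gain_gibbs// policy_gain_le.
(* The upper bound is the Gibbs gain; the integral exceeds [-oo] because it dominates that of the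
   Gibbs gain. *)
have ipi : rho.-integrable setT (policy_gain pi).
  apply: (integrable_ae_le (measurable_policy_gain ppi) ig le_gain).
  apply: lt_le_trans Jle.
  by have := integrable_fin_num measurableT ig; rewrite fin_numElt => /andP[].
apply: filterS2 hK (ae_eq_of_le_integral ipi ig le_gain Jle) => q hq.
rewrite policy_gain_gibbs//.
apply: (expected_gain_eq halpha hbeta K0 _ _ _ _ hq).
- exact: (measurable_fun_pair2 q (measurable_advantage eps pold)).
- by move=> o; exact: advantage_bounded.
- exact: policy_density.
- exact: policy_density.
- exact: policy_density.
Qed.

(** The induction step for comparability with the reference; the new constant is again uniform in
    [q]. *)
Lemma argmax_comparable pi :
  is_argmax mu (objective rho mu r alpha beta eps piref piold) pi ->
  {ae rho, forall q, comparable_density mu (L + L) (piref q) (pi q)}.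
Proof.
move=> /argmax_gibbs; apply: filterS2 hK => q hq.
have := gibbs_comparable halpha hbeta K0
  (measurable_fun_pair2 q (measurable_advantage eps pold))
  (fun o => advantage_bounded q o heps pold)
  (policy_density q pref) (policy_density q pold) hq.
by apply: filterS2 => o + -> .
Qed.

End step.
End argmax.

(** * Conditional masses and the logit recursion *)

Section conditional_mass.
Context {d : measure_display} {O : measurableType d} {R : realType}.
Variables (mu : {measure set O -> \bar R}) (alpha K : R) (a b : O -> R) (s : O -> bool).
Hypotheses (halpha : 0 < alpha < 1) (K0 : 0 <= K).
Hypotheses (da : is_density mu a) (db : is_density mu b).
Hypothesis hab : comparable_density mu K a b.
Hypothesis ms : measurable_fun setT s.

Let mass (f : O -> R) : R := fine (\int[mu]_o (f o * (s o)%:R)%:E)%E.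
Let m o : R := a o `^ alpha * b o `^ (1 - alpha).

Lemma measurable_indicator : measurable_fun setT (fun o => (s o)%:R : R).
Proof.
rewrite (_ : (fun _ => _) = (fun o => if s o then 1 else 0)).
  exact: measurable_fun_ifT.
by apply/funext => o; case: (s o).
Qed.

Lemma integrable_mass f : mu.-integrable setT (EFin \o f) ->
  mu.-integrable setT (fun o => (f o * (s o)%:R)%:E).
Proof.
move=> fi; apply: (le_integrable measurableT _ _ fi).
  apply/measurable_EFinP; apply: measurable_funM; last exact: measurable_indicator.
  by apply/measurable_EFinP; exact: measurable_int fi.
move=> o _ /=; rewrite lee_fin normrM ler_piMr//.
by case: (s o); rewrite ?normr1 ?normr0.
Qed.

Lemma massE f : mu.-integrable setT (EFin \o f) ->
  (\int[mu]_o (f o * (s o)%:R)%:E = (mass f)%:E)%E.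
Proof.
by move=> fi; rewrite fineK//; apply: integrable_fin_num => //; exact: integrable_mass.
Qed.

Lemma massZ k f : mu.-integrable setT (EFin \o f) ->
  mass (fun o => k * f o) = k * mass f.
Proof.
move=> fi; rewrite /mass.
under eq_integral do rewrite -mulrA EFinM.
by rewrite integralZl// ?massE//; exact: integrable_mass.
Qed.

Lemma le_mass f g : mu.-integrable setT (EFin \o f) -> mu.-integrable setT (EFin \o g) ->
  {ae mu, forall o, f o <= g o} -> mass f <= mass g.
Proof.
move=> fi gi fg; rewrite -lee_fin -!massE//.
apply: ae_le_integral; [exact: integrable_mass..|].
by apply: filterS fg => o fg; rewrite lee_fin ler_wpM2r.
Qed.

Lemma geometric_mean_comparable : comparable_density mu K a m.
Proof.
have [[_ a0 _] [_ b0 _]] := (da, db).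
apply: filterS hab => o /andP[ab ba].
by rewrite powR_mix_ge// powR_mix_le.
Qed.

Lemma measurable_geometric_mean : measurable_fun setT m.
Proof.
have [[ma _ _] [mb _ _]] := (da, db).
by apply: measurable_funM; [exact: measurableT_comp (measurable_powR _) ma
  |exact: measurableT_comp (measurable_powR _) mb].
Qed.

Lemma integrable_geometric_mean : mu.-integrable setT (EFin \o m).
Proof.
apply: (integrable_ae_between _ (density_integrableZ (expR (- K)) da)
  (density_integrableZ (expR K) da)).
- exact/measurable_EFinP/measurable_geometric_mean.
- by apply: filterS geometric_mean_comparable => o /andP[]; rewrite lee_fin.
- by apply: filterS geometric_mean_comparable => o /andP[]; rewrite lee_fin.
Qed.

(** Carries positivity of the success and failure masses from the reference to any comparable
    function, so that every logarithm below has a positive argument. *)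
Lemma mass_comparable_gt0 f : mu.-integrable setT (EFin \o f) ->
  comparable_density mu K a f -> 0 < mass a -> 0 < mass f.
Proof.
move=> fi af a0; apply: (@lt_le_trans _ _ (expR (- K) * mass a)).
  by rewrite mulr_gt0// expR_gt0.
rewrite -massZ; last exact: density_integrable.
apply: le_mass => //; first exact: density_integrableZ.
by apply: filterS af => o /andP[].
Qed.

(** The normalizing constants leave the integral as the factor [c]; the remaining mass is positive
    and finite, so [lne] is a real logarithm and splits. *)
Lemma renyi_cond pa pb : 0 < pa -> 0 < pb -> 0 < mass a ->
  renyi mu alpha (fun o => a o * (s o)%:R / pa) (fun o => b o * (s o)%:R / pb) =
  ((alpha - 1)^-1 * (ln (mass m) - alpha * ln pa - (1 - alpha) * ln pb))%:E.
Proof.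
move=> pa0 pb0 ha; have [[_ a0 _] [_ b0 _]] := (da, db).
have /andP[al0 al1] := halpha.
have m0 : 0 < mass m.
  by apply: mass_comparable_gt0 => //;
    [exact: integrable_geometric_mean|exact: geometric_mean_comparable].
pose c := (pa `^ alpha * pb `^ (1 - alpha))^-1.
have c0 : 0 < c by rewrite invr_gt0 mulr_gt0 ?powR_gt0.
rewrite /renyi (eq_integral (fun o => c%:E * (m o * (s o)%:R)%:E)%E); last first.
  move=> o _; rewrite -EFinM; congr EFin; case: (s o); last first.
    (* Off the event the integrand vanishes because [alpha] is nonzero; the convention is that 0 to
       the power 0 is 1. *)
    by rewrite !mulr0 !mul0r powR0 ?gt_eqF// mul0r.
  rewrite !mulr1 !powRM ?invr_ge0 ?(ltW pa0) ?(ltW pb0)//.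
  (* Writing inverses as powers of exponent -1 makes the power of an inverse and the inverse of a
     power coincide. *)
  rewrite /c invfM -!powR_inv1 ?powR_ge0 ?(ltW pa0) ?(ltW pb0)// -!powRrM.
  rewrite ![_ * -1]mulrC /m; ring.
rewrite integralZl//; last exact/integrable_mass/integrable_geometric_mean.
rewrite massE; last exact: integrable_geometric_mean.
rewrite -EFinM lne_EFin ?mulr_gt0// -EFinM; congr (_ * _)%:E.
rewrite lnM ?posrE// /c lnV ?posrE ?mulr_gt0 ?powR_gt0//.
by rewrite lnM ?posrE ?powR_gt0// !ln_powR; ring.
Qed.

End conditional_mass.

(** * The logit update at a fixed prompt *)

Section logit_update.
Context {d : measure_display} {O : measurableType d} {R : realType}.
Variables (mu : {measure set O -> \bar R}) (alpha beta eps K : R).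
Variables (a b f A : O -> R) (s : O -> bool) (cS cF Z : R).
Hypotheses (halpha : 0 < alpha < 1) (hbeta : 0 < beta) (K0 : 0 <= K) (Z0 : 0 < Z).
Hypotheses (da : is_density mu a) (db : is_density mu b) (df : is_density mu f).
Hypothesis hab : comparable_density mu K a b.
Hypothesis ms : measurable_fun setT s.
Hypothesis hA : forall o, A o = if s o then cS else cF.
Hypothesis hf : {ae mu, forall o,
  f o = gibbs_weight alpha beta (A o) (a o) (b o) / Z}.

Let mass (s : O -> bool) (f : O -> R) : R := fine (\int[mu]_o (f o * (s o)%:R)%:E)%E.
Let fail o := ~~ s o.
Let m o : R := a o `^ alpha * b o `^ (1 - alpha).

Lemma mass_fail g : is_density mu g -> 1 - mass s g = mass fail g.
Proof.
move=> dg; have gi := density_integrable dg; have mfail := measurable_neg ms.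
have [_ _ g1] := dg.
apply/eqP; rewrite subr_eq addrC -eqe EFinD /mass -!massE//.
rewrite -integralD//; [|exact: integrable_mass..].
rewrite -g1; apply/eqP; apply: eq_integral => o _; rewrite -EFinD /fail.
by case: (s o); rewrite /= mulr1 mulr0 ?addr0 ?add0r.
Qed.

(** The advantage is constant on the event, so the exponential and [Z] factor out; this serves for
    successes and for failures. *)
Lemma mass_gibbs (t : O -> bool) c : measurable_fun setT t ->
  (forall o, t o -> A o = c) -> mass t f = expR (c / beta) / Z * mass t m.
Proof.
move=> mt tA; have im := integrable_geometric_mean halpha K0 da db hab.
rewrite /mass -massZ//; congr fine; have [mf _ _] := df.
have mt' := measurable_indicator mt.
apply: ae_eq_integral => //.
- by apply/measurable_EFinP; exact: measurable_funM.
- apply/measurable_EFinP; apply: measurable_funM => //.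
  by apply: measurable_funM => //; exact: measurable_geometric_mean da db.
apply: filterS hf => o -> _; congr EFin; case: (boolP (t o)) => [/tA ->|_].
  by rewrite /gibbs_weight /m; ring.
by rewrite !mulr0.
Qed.

(** In the ratio of success to failure mass [Z] cancels. Since [(1 - alpha) * (alpha - 1)^-1 = -1],
    the Renyi term is the log ratio of the masses of [m] minus the weighted logits of [a] and [b],
    which the first two terms restore. *)
Lemma logit_gibbs : 0 < mass s a < 1 ->
  0 < mass s f < 1 /\
  ((logit (mass s f))%:E =
     alpha%:E * (logit (mass s a))%:E + (1 - alpha)%:E * (logit (mass s b))%:E
     + (1 - alpha)%:E *
       (renyi mu alpha (fun o => (a o * (~~ s o)%:R / (1 - mass s a))%R)
                       (fun o => (b o * (~~ s o)%:R / (1 - mass s b))%R)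
        - renyi mu alpha (fun o => (a o * (s o)%:R / mass s a)%R)
                         (fun o => (b o * (s o)%:R / mass s b)%R))
     + ((cS - cF) / beta)%:E)%E.
Proof.
move=> /andP[aS0 aS1]; have /andP[al0 al1] := halpha.
have mfail : measurable_fun setT fail by exact: measurable_neg.
have aF0 : 0 < mass fail a by rewrite -mass_fail// subr_gt0.
have pos g (t : O -> bool) (mt : measurable_fun setT t) :
    mu.-integrable setT (EFin \o g) -> comparable_density mu K a g ->
    0 < mass t a -> 0 < mass t g.
  exact: mass_comparable_gt0.
have im := integrable_geometric_mean halpha K0 da db hab.
have cm := geometric_mean_comparable halpha K0 da db hab.
have ib := density_integrable db.
have [bS0 bF0] : 0 < mass s b /\ 0 < mass fail b by split; exact: pos.
have [mS0 mF0] : 0 < mass s m /\ 0 < mass fail m by split; exact: pos.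
have fS : mass s f = expR (cS / beta) / Z * mass s m.
  by apply: mass_gibbs => // o so; rewrite hA so.
have fF : mass fail f = expR (cF / beta) / Z * mass fail m.
  by apply: mass_gibbs => // o /negbTE so; rewrite hA so.
have fS0 : 0 < mass s f by rewrite fS mulr_gt0// divr_gt0// expR_gt0.
have fF0 : 0 < mass fail f by rewrite fF mulr_gt0// divr_gt0// expR_gt0.
split; first by rewrite fS0/= -subr_gt0 mass_fail.
rewrite /logit !mass_fail//.
rewrite (renyi_cond halpha K0 da db hab mfail)//.
rewrite (renyi_cond halpha K0 da db hab ms)//.
rewrite -/(mass s m) -/(mass fail m).
rewrite -!EFinM -!EFinD; congr EFin.
rewrite !ln_div ?posrE// fS fF !lnM ?posrE ?divr_gt0 ?expR_gt0 ?invr_gt0//.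
rewrite !expRK; field.
by rewrite gt_eqF//= subr_eq0 lt_eqF.
Qed.

End logit_update.

(** The gap between the advantages of a success and of a failure. *)
Lemma omega_plus_minus (R : realType) (eps p : R) :
  omega_plus eps p + omega_minus eps p = Omega eps p.
Proof. by rewrite /omega_plus /omega_minus /Omega -mulrDl subrK mul1r. Qed.

(** The bounds on [psucc] certify that [logit] is evaluated where it is meaningful; the identity is
    extended-real because [renyi] is. *)
Theorem theorem9 (R : realType) (dQ dO : measure_display)
    (Q : measurableType dQ) (O : measurableType dO)
    (rho : probability Q R) (mu : {sigma_finite_measure set O -> \bar R})
    (r : Q -> O -> bool) (alpha beta eps : R)
    (piref : Q -> O -> R) (pi : nat -> Q -> O -> R)
    (hr : measurable_fun [set: Q * O] (fun x : Q * O => r x.1 x.2))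
    (halpha : 0 < alpha < 1) (hbeta : 0 < beta) (heps : 0 < eps <= 1)
    (hpiref : is_policy mu piref)
    (hpref : {ae rho, forall q, 0 < psucc mu r piref q < 1})
    (hpi0 : pi 0%N = piref)
    (hpi : forall n : nat, (1 <= n)%N ->
       is_argmax mu (objective rho mu r alpha beta eps piref (pi n.-1))
                 (pi n)) :
  {ae rho, forall q, forall n : nat, (1 <= n)%N ->
    0 < psucc mu r (pi n) q < 1 /\
    ((logit (psucc mu r (pi n) q))%:E =
       alpha%:E * (logit (psucc mu r piref q))%:E
       + (1 - alpha)%:E * (logit (psucc mu r (pi n.-1) q))%:E
       + (1 - alpha)%:E *
           (renyi mu alpha (cond_F mu r piref q) (cond_F mu r (pi n.-1) q)
            - renyi mu alpha (cond_S mu r piref q) (cond_S mu r (pi n.-1) q))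
       + (Omega eps (psucc mu r (pi n.-1) q) / beta)%:E)%E}.
Proof.
have eps0 : 0 < eps by case/andP: heps.
have pol n : is_policy mu (pi n).
  by case: n => [|n]; [rewrite hpi0|case: (hpi n.+1 isT)].
have sqrt0 : 0 <= (Num.sqrt eps)^-1 / beta.
  by rewrite divr_ge0 ?invr_ge0 ?sqrtr_ge0// ltW.
(* The constant may grow with [n], but for each [n] it is the same for almost all prompts. *)
have comp n : exists2 K, 0 <= K &
    {ae rho, forall q, comparable_density mu K (piref q) (pi n q)}.
  elim: n => [|n [K K0 hK]].
    exists 0 => //; rewrite hpi0; apply: aeW => q; apply: aeW => o.
    by rewrite oppr0 expR0 mul1r lexx.
  eexists; last exact: (argmax_comparable hr halpha hbeta eps0 hpiref (pol n) K0 hK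
    (hpi n.+1 isT)).
  by rewrite !addr_ge0.
(* A null set for each [n] suffices, since countably many null sets have a null union. *)
suff main n : {ae rho, forall q, 0 < psucc mu r (pi n.+1) q < 1 /\
    ((logit (psucc mu r (pi n.+1) q))%:E =
       alpha%:E * (logit (psucc mu r piref q))%:E
       + (1 - alpha)%:E * (logit (psucc mu r (pi n) q))%:E
       + (1 - alpha)%:E *
           (renyi mu alpha (cond_F mu r piref q) (cond_F mu r (pi n) q)
            - renyi mu alpha (cond_S mu r piref q) (cond_S mu r (pi n) q))
       + (Omega eps (psucc mu r (pi n) q) / beta)%:E)%E}.
  by apply: filterS (ae_foralln main) => q hq [//|n] _; exact: hq.
have [K K0 hK] := comp n.
have hg := argmax_gibbs hr halpha hbeta eps0 hpiref (pol n) K0 hK (hpi n.+1 isT).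
apply: filterS3 hpref hK hg => q hq hKq hgq.
have /andP[Z0 _] := policy_partition_bounds hr halpha hbeta eps0 hpiref (pol n) K0 hKq.
(* The double opposite exhibits [Omega] as [cS - cF], with [cF] the negative advantage of a
   failure. *)
rewrite /cond_F /cond_S -omega_plus_minus -[omega_minus _ _]opprK.
rewrite psuccE in hq *; rewrite !psuccE.
apply: (logit_gibbs halpha hbeta K0 (lt_le_trans (expR_gt0 _) Z0)
  (policy_density q hpiref) (policy_density q (pol n)) (policy_density q (pol n.+1))
  hKq (measurable_fun_pair2 q hr) _ hgq hq).
by move=> o; rewrite /advantage psuccE.
Qed.
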